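(* Let $n$ be even and $F\colon\mathbb F_2^n\to\mathbb F_2^n$ a plateaued APN function. Then it is not the case that $F$ has the following value distribution: $|\mathrm{Im}(F)|=\frac{2^n+2}{3}$, exactly two elements of $\mathrm{Im}(F)$ have preimage sets of size $2$, and all other $\frac{2^n-4}{3}$ elements of $\mathrm{Im}(F)$ have preimage sets of size $3$.
   Context: Scalar product $\langle x,y\rangle=\sum x_iy_i$; components $F_b(x)=\langle b,F(x)\rangle$; $W_f(a)=\sum_x(-1)^{f(x)+\langle a,x\rangle}$. $f$ is $t$-plateaued if $|W_f(a)|\in\{0,2^{(n+t)/2}\}$ for all $a$. $F$ is plateaued if each $F_b$, $b\ne0$, is $s_b$-plateaued for some $s_b$. $F$ is APN if for all $a\ne0$ and all $b$ the equation $F(x+a)+F(x)=b$ has at most $2$ solutions. $\mathrm{Im}(F)$ is the image set. *)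

(* Defs.v *)
From mathcomp Require Import all_boot all_order all_algebra all_field.
Set Implicit Arguments.
Unset Strict Implicit.
Unset Printing Implicit Defensive.
Import Order.TTheory GRing.Theory Num.Theory.
Local Open Scope ring_scope.

Definition scalp (n : nat) (x y : 'rV['F_2]_n) : 'F_2 :=
  \sum_(i < n) x 0 i * y 0 i.

Definition component (n : nat) (F : 'rV['F_2]_n -> 'rV['F_2]_n)
    (b x : 'rV['F_2]_n) : 'F_2 :=
  scalp b (F x).

(* The exponent is the representative in {0, 1} of an element of 'F_2. *)
Definition walsh (n : nat) (f : 'rV['F_2]_n -> 'F_2) (a : 'rV['F_2]_n) : int :=
  \sum_(x : 'rV['F_2]_n) (-1) ^+ nat_of_ord (f x + scalp a x).

(* The exponent (n + t) / 2 need not be an integer a priori, so the amplitude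
   2^((n + t) / 2) is taken in algC as the nonnegative square root of
   2^(n + t). *)
Definition t_plateaued (n t : nat) (f : 'rV['F_2]_n -> 'F_2) : Prop :=
  forall a : 'rV['F_2]_n,
    `|walsh f a|%:~R = 0 :> algC \/
    `|walsh f a|%:~R = sqrtC (2 ^+ (n + t)) :> algC.

Definition plateaued (n : nat) (F : 'rV['F_2]_n -> 'rV['F_2]_n) : Prop :=
  forall b : 'rV['F_2]_n, b != 0 ->
    exists s : nat, t_plateaued s (component F b).

Definition APN (n : nat) (F : 'rV['F_2]_n -> 'rV['F_2]_n) : Prop :=
  forall a b : 'rV['F_2]_n, a != 0 ->
    (#|[set x : 'rV['F_2]_n | (F (x + a) + F x)%R == b]| <= 2)%N.

Definition image_set (n : nat) (F : 'rV['F_2]_n -> 'rV['F_2]_n) :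
    {set 'rV['F_2]_n} :=
  F @: [set: 'rV['F_2]_n].

Definition preim_size (n : nat) (F : 'rV['F_2]_n -> 'rV['F_2]_n)
    (y : 'rV['F_2]_n) : nat :=
  #|F @^-1: [set y]|.

(* Main.v *)
(* Put N = 2 ^ n, W_b = the Walsh transform of the component F_b, and
   D_b = \sum_a W_b(a)^4 - N^2 W_b(0)^2.  By Parseval, \sum_a W_b(a)^4 is N^2
   times the squared amplitude A_b of F_b, so D_b = 0 when W_b(0) != 0 and
   D_b = N^2 A_b otherwise.  In the latter case Parseval gives A_b > N, and as
   A_b is a square and a power of 2 while n is even, D_b >= 4 N^3.  On the other
   hand the APN property determines \sum_b \sum_a W_b(a)^4 and the value
   distribution determines \sum_b W_b(0)^2; together they give
   \sum_b D_b = 2 N^3, which is incompatible with D_b = 0 or D_b >= 4 N^3. *)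

Require Import Defs.
From mathcomp Require Import all_boot all_order all_algebra all_field.
From mathcomp Require Import ring zify.
Import Order.TTheory GRing.Theory Num.Theory.

Section WalshAnalysis.

Set Implicit Arguments.
Unset Strict Implicit.
Unset Printing Implicit Defensive.
Local Open Scope ring_scope.

Local Notation scalp := Defs.scalp.

(** * Characters of F_2^n and the Fourier transform *)

Definition chi (u : 'F_2) : int := (-1) ^+ nat_of_ord u.

Lemma F2_cases (u : 'F_2) : u = 0 \/ u = 1.
Proof.
by case: u => [[|[|k]] lt_k] //; [left | right]; apply: val_inj.
Qed.

Lemma chiD : {morph chi : u v / u + v >-> u * v}.
Proof.
by move=> u v; case: (F2_cases u) => ->; case: (F2_cases v) => ->.
Qed.

Lemma chi_sqr u : chi u ^+ 2 = 1.
Proof. by case: (F2_cases u) => ->. Qed.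

Lemma addvv n (x : 'rV['F_2]_n) : x + x = 0.
Proof.
by apply/rowP => i; rewrite !mxE; case: (F2_cases (x 0 i)) => ->; apply: val_inj.
Qed.

Lemma addvK n (x : 'rV['F_2]_n) : cancel (+%R^~ x) (+%R^~ x).
Proof. by move=> y; rewrite -addrA addvv addr0. Qed.

Lemma addv_eq0 n (x y : 'rV['F_2]_n) : (x + y == 0) = (x == y).
Proof. by rewrite -(inj_eq (can_inj (addvK y))) addvK add0r. Qed.

Lemma scalpC n (x y : 'rV['F_2]_n) : scalp x y = scalp y x.
Proof. by apply: eq_bigr => i _; rewrite mulrC. Qed.

Lemma scalpDr n (x y z : 'rV['F_2]_n) : scalp x (y + z) = scalp x y + scalp x z.
Proof. by rewrite -big_split; apply: eq_bigr => i _; rewrite mxE mulrDr. Qed.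

Lemma scalp0l n (x : 'rV['F_2]_n) : scalp 0 x = 0.
Proof. by apply: big1 => i _; rewrite mxE mul0r. Qed.

Lemma scalp_delta n (x : 'rV['F_2]_n) i : scalp x (delta_mx 0 i) = x 0 i.
Proof.
rewrite /scalp (bigD1 i) //= big1 => [|j ne_ji]; rewrite mxE ?eqxx.
  by rewrite mulr1 addr0.
by rewrite (negPf ne_ji) andbF mulr0.
Qed.

Lemma card_rVF2 n : #|{: 'rV['F_2]_n}| = (2 ^ n)%N.
Proof. by rewrite card_mx mul1n card_Fp. Qed.

Lemma sum_chi n (x : 'rV['F_2]_n) :
  \sum_(a : 'rV['F_2]_n) chi (scalp a x) = (2 ^ n)%:R *+ (x == 0).
Proof.
have [-> | nz_x] := eqVneq x 0.
  rewrite (eq_bigr (fun=> 1)) => [|a _]; last by rewrite scalpC scalp0l.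
  by rewrite sumr_const card_rVF2.
have [i xi] : exists i, x 0 i = 1.
  case/rV0Pn: nz_x => i; case: (F2_cases (x 0 i)) => xi; rewrite xi // => _.
  by exists i.
(* Translating the summation variable by e_i changes the sign of the sum. *)
set S := LHS; suff: S = - S by rewrite mulr0n; lia.
rewrite {1}/S (reindex_inj (can_inj (addvK (delta_mx 0 i)))) -sumrN.
apply: eq_bigr => a _; rewrite scalpC scalpDr scalp_delta xi chiD scalpC.
by rewrite mulrC mulN1r.
Qed.

Definition fourier n (h : 'rV['F_2]_n -> int) (a : 'rV['F_2]_n) : int :=
  \sum_x h x * chi (scalp a x).

Lemma parseval n (h : 'rV['F_2]_n -> int) :
  \sum_a fourier h a ^+ 2 = (2 ^ n)%:R * \sum_x h x ^+ 2.
Proof.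
transitivity (\sum_a \sum_x \sum_y h x * h y * chi (scalp a (x + y))).
  apply: eq_bigr => a _; rewrite expr2 mulr_suml; apply: eq_bigr => x _.
  rewrite mulr_sumr; apply: eq_bigr => y _; rewrite scalpDr chiD; ring.
rewrite exchange_big mulr_sumr; apply: eq_bigr => x _ /=.
rewrite exchange_big (bigD1 x) //= [X in _ + X]big1 => [|y ne_yx];
  rewrite -mulr_sumr sum_chi addv_eq0.
  by rewrite eqxx /=; ring.
by rewrite eq_sym (negPf ne_yx) mulr0.
Qed.

(** * Moments of the Walsh transform *)

Lemma walshE n (f : 'rV['F_2]_n -> 'F_2) a : walsh f a = fourier (chi \o f) a.
Proof. by apply: eq_bigr => x _; rewrite -[_ ^+ _]/(chi _) chiD. Qed.

Lemma sum_walsh_sqr n (f : 'rV['F_2]_n -> 'F_2) :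
  \sum_a walsh f a ^+ 2 = (2 ^ n)%:R ^+ 2.
Proof.
under eq_bigr do rewrite walshE.
rewrite parseval.
rewrite (eq_bigr (fun=> 1)) => [|x _]; last exact: chi_sqr.
by rewrite sumr_const card_rVF2.
Qed.

Definition autocorr n (f : 'rV['F_2]_n -> 'F_2) (u : 'rV['F_2]_n) : int :=
  \sum_x chi (f (x + u) + f x).

(** Wiener-Khinchin: in the double sum for the square, substitute [x + u] for the second variable;
    the characters then combine to [chi (scalp a u)]. Parseval for [autocorr f] thus yields the
    fourth moment. *)
Lemma walsh_sqr n (f : 'rV['F_2]_n -> 'F_2) a :
  walsh f a ^+ 2 = fourier (autocorr f) a.
Proof.
rewrite walshE {2}/fourier; under [RHS]eq_bigr do rewrite mulr_suml.
rewrite [RHS]exchange_big /fourier expr2 mulr_suml; apply: eq_bigr => x _ /=.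
rewrite mulr_sumr (reindex_inj (addrI x)); apply: eq_bigr => u _ /=.
rewrite !chiD scalpDr chiD.
have := chi_sqr (scalp a x); rewrite expr2 => sq.
transitivity (chi (f (x + u)) * chi (f x) * chi (scalp a u)
              * (chi (scalp a x) * chi (scalp a x))); first by ring.
by rewrite sq mulr1.
Qed.

Lemma sum_walsh_quart n (f : 'rV['F_2]_n -> 'F_2) :
  \sum_a walsh f a ^+ 4 = (2 ^ n)%:R * \sum_u autocorr f u ^+ 2.
Proof.
by rewrite -parseval; apply: eq_bigr => a _; rewrite (exprM _ 2 2) walsh_sqr.
Qed.

(** Grouping [x] by the value of [g] turns the inner sum into the Fourier transform of the
    fibre-size function, to which Parseval applies. It serves both for the derivatives of [F] and
    for [F] itself. *)
Lemma sum_sqr_fibers n (T : finType) (g : T -> 'rV['F_2]_n) :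
  \sum_b (\sum_x chi (scalp b (g x))) ^+ 2
  = (2 ^ n)%:R * \sum_v (#|g @^-1: [set v]| ^ 2)%:R.
Proof.
under [in RHS]eq_bigr do rewrite natrX.
rewrite -(parseval (fun v => #|g @^-1: [set v]|%:R)); apply: eq_bigr => b _.
congr (_ ^+ 2); rewrite (partition_big g xpredT) //=; apply: eq_bigr => v _.
rewrite (eq_bigr (fun=> chi (scalp b v))) => [|x /eqP-> //].
rewrite sumr_const -[LHS]mulr_natl; congr (_%:R * _).
by apply: eq_card => x; rewrite !inE.
Qed.

(** * Walsh spectra of plateaued functions *)

Lemma t_plateaued_sqr n s (f : 'rV['F_2]_n -> 'F_2) a :
  t_plateaued s f -> walsh f a = 0 \/ walsh f a ^+ 2 = 2 ^+ (n + s).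
Proof.
move=> /(_ a) [/eqP | Wa].
  by rewrite intr_eq0 normr_eq0 => /eqP; left.
(* Squaring removes the root in [algC], so the equality descends to integers. *)
right; apply: (@intr_inj algC).
by rewrite -real_normK ?num_real // !rmorphXn /= Wa sqrtCK.
Qed.

Lemma even_exponent_of_sqr (w : int) m : w ^+ 2 = 2 ^+ m -> ~~ odd m.
Proof.
move=> /(congr1 absz); rewrite !abszX => eq_w.
have /(congr1 (logn 2)) : (`|w| ^ 2 = 2 ^ m)%N by [].
by rewrite lognX pfactorK // mul2n => <-; rewrite odd_double.
Qed.

Lemma plateaued_dichotomy n s (f : 'rV['F_2]_n -> 'F_2) :
    ~~ odd n -> t_plateaued s f ->
  let Q := \sum_a walsh f a ^+ 4 in
  Q = (2 ^ n)%:R ^+ 2 * walsh f 0 ^+ 2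
  \/ walsh f 0 = 0 /\ 4%:R * (2 ^ n)%:R ^+ 3 <= Q.
Proof.
move=> even_n f_plat Q; set N : int := (2 ^ n)%:R.
have N_gt0 : 0 < N by rewrite ltr0n expn_gt0.
have defQ : Q = 2 ^+ (n + s) * N ^+ 2.
  rewrite -(sum_walsh_sqr f) mulr_sumr; apply: eq_bigr => a _.
  case: (t_plateaued_sqr a f_plat) => Wa; first by rewrite Wa !expr0n mulr0.
  by rewrite -Wa -exprD.
case: (t_plateaued_sqr 0 f_plat) => W0; last by left; rewrite W0 defQ mulrC.
right; split=> //; rewrite defQ exprD.
have W_le a : walsh f a ^+ 2 <= 2 ^+ (n + s).
  by case: (t_plateaued_sqr a f_plat) => ->; rewrite ?expr0n ?exprn_ge0.
(* Parseval provides a nonzero Walsh value; its square is 2^(n+s), so n + s is even. *)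
have even_s : ~~ odd s.
  have [a nzWa] : exists a, walsh f a != 0.
    apply/existsP; apply: contraLR (N_gt0) => /existsPn W_0.
    have := sum_walsh_sqr f; rewrite big1 => [N2_0|a _].
      by rewrite -leNgt -(ler_pXn2r (n := 2)) ?nnegrE // -N2_0 expr0n.
    by have /negPn/eqP-> := W_0 a; rewrite expr0n.
  case: (t_plateaued_sqr a f_plat) => [Wa | /even_exponent_of_sqr].
    by rewrite Wa eqxx in nzWa.
  by rewrite oddD (negPf even_n).
(* A bent function has no Walsh zero: W(0) = 0 and Parseval exclude s = 0. *)
have s_gt0 : (0 < s)%N.
  rewrite lt0n; apply/eqP => s0.
  have : N ^+ 2 <= \sum_(a : 'rV['F_2]_n | a != 0) N.
    rewrite -(sum_walsh_sqr f) (bigD1 0) //= W0 expr0n add0r.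
    by apply: ler_sum => a _; rewrite (le_trans (W_le a)) // s0 addn0 /N natrX.
  rewrite sumr_const (eq_card (B := predC1 (0 : 'rV['F_2]_n))) // cardC1.
  rewrite card_rVF2 -mulr_natl expr2 ler_pM2r // ler_nat leqNgt.
  by rewrite ltn_predL expn_gt0.
have -> : 2 ^+ n * 2 ^+ s * N ^+ 2 = 2 ^+ s * N ^+ 3 by rewrite /N natrX; ring.
(* Being even and positive, [s] is at least 2: this is the factor 4. *)
rewrite ler_pM2r ?exprn_gt0 // -[4%:R]/((2 : int) ^+ 2) ler_eXn2l //.
by case: s s_gt0 even_s {f_plat W_le Q defQ} => [|[]].
Qed.

(** * Fourth moment of an APN function *)

Lemma APN_fiber_sqr n (F : 'rV['F_2]_n -> 'rV['F_2]_n) u v :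
    APN F -> u != 0 ->
  let c := #|(fun x => F (x + u) + F x) @^-1: [set v]| in (c ^ 2 = 2 * c)%N.
Proof.
move=> F_APN nz_u; set A := _ @^-1: _ => /=.
have A_le2 : (#|A| <= 2)%N.
  by apply: leq_trans (F_APN u v nz_u); rewrite subset_leq_card //;
     apply/subsetP => x; rewrite !inE.
(* The fibre is stable under translation by [u], so it has 0 or 2 elements, and these sizes are the
   roots of c^2 = 2c. *)
have [-> | [x Ax]] := set_0Vmem A; first by rewrite cards0.
have A_ge2 : (2 <= #|A|)%N.
  have card_pair : #|[set x; x + u]| = 2%N.
    by rewrite cards2 -addv_eq0 addrA addvv add0r nz_u.
  rewrite -[leqLHS]card_pair; apply/subset_leq_card/subsetP => y; rewrite !inE => /orP[] /eqP->.
    by rewrite !inE in Ax.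
  by move: Ax; rewrite !inE addvK addrC.
by have -> : #|A| = 2%N by apply/eqP; rewrite eqn_leq A_le2.
Qed.

Lemma sum_card_fibers (T T' : finType) (g : T -> T') :
  (\sum_v #|g @^-1: [set v]| = #|T|)%N.
Proof.
rewrite -sum1_card (partition_big g xpredT) //=; apply: eq_bigr => v _.
by rewrite -sum1_card; apply: eq_bigl => x; rewrite !inE.
Qed.

Lemma APN_sum_sqr_fibers n (F : 'rV['F_2]_n -> 'rV['F_2]_n) u :
    APN F -> u != 0 ->
  (\sum_v #|(fun x => F (x + u) + F x)%R @^-1: [set v]| ^ 2 = 2 * 2 ^ n)%N.
Proof.
move=> F_APN nz_u; under eq_bigr do rewrite APN_fiber_sqr //.
by rewrite -big_distrr /= sum_card_fibers card_rVF2.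
Qed.

Lemma sum_sqr_fibers_zero n (F : 'rV['F_2]_n -> 'rV['F_2]_n) :
  (\sum_v #|(fun x => F (x + 0) + F x)%R @^-1: [set v]| ^ 2 = (2 ^ n) ^ 2)%N.
Proof.
rewrite (bigD1 0) //= big1 => [|v nz_v].
  rewrite addn0 -card_rVF2; congr (_ ^ 2)%N; apply: eq_card => x.
  by rewrite !inE addr0 addvv eqxx.
rewrite (_ : _ @^-1: _ = set0) ?cards0 //; apply/setP => x.
by rewrite !inE addr0 addvv eq_sym (negPf nz_v).
Qed.

Lemma APN_sum_walsh_quart n (F : 'rV['F_2]_n -> 'rV['F_2]_n) :
  APN F ->
  let N : int := (2 ^ n)%:R in
  \sum_b \sum_a walsh (component F b) a ^+ 4
  = N ^+ 2 * (3%:R * N ^+ 2 - 2%:R * N).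
Proof.
move=> F_APN N; under eq_bigr do rewrite sum_walsh_quart.
rewrite -mulr_sumr exchange_big /=.
have sum_autocorr u : \sum_b autocorr (component F b) u ^+ 2 =
    N * (\sum_v #|(fun x => F (x + u) + F x)%R @^-1: [set v]| ^ 2)%:R.
  rewrite natr_sum -sum_sqr_fibers; apply: eq_bigr => b _; congr (_ ^+ 2).
  by apply: eq_bigr => x _; rewrite scalpDr.
(* The direction u = 0 contributes N^3, and each of the N - 1 others contributes 2 N^2. *)
rewrite (bigD1 0) //= sum_autocorr sum_sqr_fibers_zero.
rewrite (eq_bigr (fun=> N * (2 * 2 ^ n)%:R)) => [|u nz_u]; last first.
  by rewrite sum_autocorr APN_sum_sqr_fibers.
rewrite sumr_const (eq_card (B := predC1 (0 : 'rV['F_2]_n))) // cardC1 card_rVF2.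
rewrite -[_ *+ (2 ^ n).-1]mulr_natl -subn1 natrB ?expn_gt0 // /N !natrM !natrX; ring.
Qed.

(** * Walsh values at 0 and the value distribution *)

Lemma sum_walsh0_sqr n (F : 'rV['F_2]_n -> 'rV['F_2]_n) :
  \sum_b walsh (component F b) 0 ^+ 2
  = (2 ^ n)%:R * (\sum_v preim_size F v ^ 2)%:R.
Proof.
rewrite natr_sum -sum_sqr_fibers; apply: eq_bigr => b _; congr (_ ^+ 2).
by apply: eq_bigr => x _; rewrite scalp0l addr0.
Qed.

(** Fibre sizes k are 0, 2 or 3, and 3k - k^2 vanishes at 0 and 3 and equals 2 at k = 2. The two
    fibres of size 2 therefore account for the defect 4, and the number of fibres of size 3
    cancels. *)
Lemma sum_sqr_preim_size n (F : 'rV['F_2]_n -> 'rV['F_2]_n) :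
    #|[set y in image_set F | preim_size F y == 2%N]| = 2%N ->
    (forall y, y \in image_set F -> preim_size F y != 2%N -> preim_size F y = 3%N) ->
  (\sum_v preim_size F v ^ 2 + 4 = 3 * 2 ^ n)%N.
Proof.
move=> card2 card3; rewrite -card_rVF2 -(sum_card_fibers F) big_distrr /=.
have split_sum (h : nat -> nat) : h 0%N = 0%N ->
    (\sum_v h (preim_size F v)
     = h 2 * 2 + h 3 * #|[set y in image_set F | preim_size F y != 2%N]|)%N.
  move=> h0; rewrite (bigID (mem (image_set F))) /= [X in (_ + X)%N]big1 => [|v].
    rewrite addn0 (bigID (fun v => preim_size F v == 2%N)) /=.
    rewrite (eq_bigr (fun=> h 2%N)) => [|v /andP[_ /eqP->] //].
    rewrite [X in (_ + X)%N](eq_bigr (fun=> h 3%N)) => [|v /andP[Fv nv]].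
      rewrite !sum_nat_const -[X in (_ = h 2 * X + _)%N]card2 ![(h _ * _)%N]mulnC.
      by congr (_ * _ + _ * _)%N; apply: eq_card => v; rewrite !inE.
    by rewrite card3.
  move=> v_notin; rewrite /preim_size (_ : _ @^-1: _ = set0) ?cards0 //.
  apply/setP => x; rewrite !inE; apply: contraNF v_notin => /eqP <-.
  exact: imset_f.
by rewrite (split_sum (expn^~ 2)) // (split_sum (muln 3)) //; lia.
Qed.

(** * The contradiction *)

Lemma component_dichotomy n (F : 'rV['F_2]_n -> 'rV['F_2]_n) b :
    ~~ odd n -> plateaued F ->
  let N : int := (2 ^ n)%:R in
  let D := \sum_a walsh (component F b) a ^+ 4
           - N ^+ 2 * walsh (component F b) 0 ^+ 2 in
  D = 0 \/ 4%:R * N ^+ 3 <= D.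
Proof.
move=> even_n F_plat N D.
have [s plat_b] : exists s, t_plateaued s (component F b).
  (* [plateaued] is silent on b = 0, but the zero component has Walsh transform N at 0 and 0
     elsewhere, so it is n-plateaued, as N is the square root of 2^(n+n). *)
  have [-> | /F_plat //] := eqVneq b 0; exists n => a.
  have walsh0 : walsh (component F 0) a = N *+ (a == 0).
    rewrite -sum_chi; apply: eq_bigr => x _.
    by rewrite /component scalp0l add0r scalpC.
  rewrite walsh0; case: eqP => _; [right | by left; rewrite normr0].
  rewrite mulr1n ger0_norm ?ler0n // addnn -mul2n mulnC exprM.
  by rewrite sqrCK ?exprn_ge0 // /N rmorph_nat natrX.
have [defQ | [W0 Q_ge]] := plateaued_dichotomy even_n plat_b.
  by left; rewrite /D defQ subrr.
by right; rewrite /D W0 expr0n mulr0 subr0.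
Qed.

Lemma no_two_three_distribution n (F : 'rV['F_2]_n -> 'rV['F_2]_n) :
    ~~ odd n -> plateaued F -> APN F ->
    #|[set y in image_set F | preim_size F y == 2%N]| = 2%N ->
  ~ (forall y, y \in image_set F -> preim_size F y != 2%N -> preim_size F y = 3%N).
Proof.
move=> even_n F_plat F_APN card2 card3; set N : int := (2 ^ n)%:R.
pose D b := \sum_a walsh (component F b) a ^+ 4
            - N ^+ 2 * walsh (component F b) 0 ^+ 2.
have N3_gt0 : 0 < N ^+ 3 by rewrite exprn_gt0 // ltr0n expn_gt0.
have sumD : \sum_b D b = 2%:R * N ^+ 3.
  (* The computation is N^2 (3 N^2 - 2 N) - N^3 (3 N - 4) = 2 N^3. *)
  rewrite sumrB -mulr_sumr APN_sum_walsh_quart // sum_walsh0_sqr -/N.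
  have /(congr1 (fun k => k%:R : int)) := sum_sqr_preim_size card2 card3.
  by rewrite natrD natrM -/N => /(canRL (addrK _)) ->; ring.
have D_ge0 b : 0 <= D b.
  case: (component_dichotomy b even_n F_plat) => [|D_ge]; rewrite -/N -/(D b).
    by move->.
  by apply: le_trans D_ge; rewrite mulr_ge0 // ltW.
have [b Db] : exists b, D b != 0.
  apply/existsP; apply: contraLR (N3_gt0) => /existsPn D0.
  rewrite -leNgt -(pmulr_rle0 (x := 2%:R)) // -sumD big1 // => b _.
  exact/eqP/negPn/D0.
have [Db0 | D_ge] := component_dichotomy b even_n F_plat.
  by rewrite /D Db0 eqxx in Db.
(* All terms are nonnegative, so this single one, at least 4 N^3, would be bounded by the total 2
   N^3. *)
have : D b <= \sum_b D b by rewrite (bigD1 b) //= lerDl sumr_ge0.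
rewrite sumD; apply/negP; rewrite -ltNge; apply: lt_le_trans D_ge.
by rewrite ltr_pM2r.
Qed.

End WalshAnalysis.

(* For even n, both divisions by 3 are exact as soon as 2 <= n; for n = 0 the
   image has a single element, so the first two conditions are incompatible. *)
Theorem theorem6p7 (n : nat) (F : 'rV['F_2]_n -> 'rV['F_2]_n)
    (n_even : ~~ odd n) (F_plateaued : plateaued F) (F_APN : APN F) :
  ~ [/\ #|image_set F| = (2 ^ n + 2) %/ 3,
        #|[set y in image_set F | preim_size F y == 2]| = 2,
        #|[set y in image_set F | preim_size F y != 2]| = (2 ^ n - 4) %/ 3
      & forall y : 'rV['F_2]_n, y \in image_set F -> preim_size F y != 2 ->
          preim_size F y = 3].
Proof.
move=> [_ card2 _ card3].
exact: (no_two_three_distribution n_even F_plateaued F_APN card2 card3).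
Qed.
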